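(* For every integer $d\ge5$, there exists an ellipsoid $E\subset\mathbb R^d$ such that the lattice polytope $P(E)=\operatorname{conv}\big(\operatorname{conv}(E)\cap\mathbb Z^d\big)$, i.e., the convex hull of the lattice points in the solid ellipsoid bounded by $E$, is not normal.
   Context: A polytope $P\subset\mathbb R^d$ is normal if it is a lattice polytope (all vertices in $\mathbb Z^d$) and for every natural number $c$ and every $x\in(cP)\cap\mathbb Z^d$ there exist $x_1,\ldots,x_c\in P\cap\mathbb Z^d$ with $x_1+\cdots+x_c=x$. (No condition is imposed on the subgroup of $\mathbb Z^d$ generated by differences of lattice points of $P$.) An ellipsoid $E\subset\mathbb R^d$ is a set of the form $\{x\in\mathbb R^d \mid (l_1(x)-a_1)^2+\cdots+(l_d(x)-a_d)^2=1\}$, where $l_1,\ldots,l_d$ is a full-rank system of real linear forms on $\mathbb R^d$ and $a_1,\ldots,a_d\in\mathbb R$. *)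

(* Defs.v *)
From mathcomp Require Import all_boot all_order all_algebra.
From mathcomp Require Import all_classical all_reals convex.

Set Implicit Arguments.
Unset Strict Implicit.
Unset Printing Implicit Defensive.

Import Order.TTheory GRing.Theory Num.Theory.

Local Open Scope classical_set_scope.
Local Open Scope ring_scope.

Definition conv_hull (R : realType) (d : nat) (A : set 'rV[R]_d) :
    set 'rV[R]_d :=
  smallest (@convex_set R 'rV[R]_d) A.

Definition int_points (R : realType) (d : nat) : set 'rV[R]_d :=
  [set x | x \is a mxOver Num.int].
Arguments int_points : clear implicits.

(* The empty set is counted as a polytope. *)
Definition polytope (R : realType) (d : nat) (P : set 'rV[R]_d) : Prop :=
  exists2 S : set 'rV[R]_d, finite_set S & P = conv_hull S.

(* A vertex is a 0-dimensional face: some linear form attains its maximum over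
   P at v and nowhere else. *)
Definition vertex (R : realType) (d : nat) (P : set 'rV[R]_d) (v : 'rV[R]_d) :
    Prop :=
  P v /\ exists l : {scalar 'rV[R]_d}, forall y, P y -> y <> v -> l y < l v.

Definition lattice_polytope (R : realType) (d : nat) (P : set 'rV[R]_d) :
    Prop :=
  polytope P /\ vertex P `<=` int_points R d.

Definition normal_polytope (R : realType) (d : nat) (P : set 'rV[R]_d) :
    Prop :=
  lattice_polytope P /\
  forall (c : nat) (x : 'rV[R]_d),
    ([set c%:R *: y | y in P] `&` int_points R d) x ->
    exists2 z : 'I_c -> 'rV[R]_d,
      (forall i, (P `&` int_points R d) (z i)) & \sum_(i < c) z i = x.

(* The matrix has as its rows the coefficients of the linear forms l i in the
   standard basis. *)
Definition full_rank_system (R : realType) (d : nat)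
    (l : 'I_d -> {scalar 'rV[R]_d}) : Prop :=
  \rank (\matrix_(i < d, j < d) l i (delta_mx 0 j)) = d.

(* The ellipsoid is the boundary surface, not the solid body. *)
Definition ellipsoid (R : realType) (d : nat) (E : set 'rV[R]_d) : Prop :=
  exists (l : 'I_d -> {scalar 'rV[R]_d}) (a : 'I_d -> R),
    full_rank_system l /\
    E = [set x | \sum_(i < d) (l i x - a i) ^+ 2 = 1].

Definition ellipsoid_polytope (R : realType) (d : nat) (E : set 'rV[R]_d) :
    set 'rV[R]_d :=
  conv_hull (conv_hull E `&` int_points R d).

(* Main.v *)
(** The lattice Z^5 + Z (1/2, ..., 1/2) has an empty Delaunay simplex of
    normalized volume 2, with vertices 0, e_1, ..., e_5: with S = sum_i x_i, the
    function sum_i (5 x_i + S - 2)^2 equals 20 at these six points and is larger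
    at all other lattice points.  In the lattice basis
    e_1, ..., e_4, (1/2, ..., 1/2) the sixth vertex is e_5 = (-1, -1, -1, -1, 2),
    so the last coordinate of every lattice point of the simplex is even.  Half
    the sum of the six vertices is the lattice point (0, 0, 0, 0, 1) of the
    third dilate of the simplex, and its last coordinate is odd.  In dimension
    d > 5 a further term (5 y)^2 for each extra coordinate y excludes the
    lattice points with y <> 0. *)

Require Import Defs.
From mathcomp Require Import all_boot all_order all_algebra.
From mathcomp Require Import all_classical all_reals.
From HB Require Import structures.
From mathcomp Require Import interval_inference convex ring lra zify.

Set Implicit Arguments.
Unset Strict Implicit.
Unset Printing Implicit Defensive.

Import Order.TTheory GRing.Theory Num.Theory.

Local Open Scope classical_set_scope.
Local Open Scope ring_scope.

(** * Convex hulls and convexity of sums of squares *)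

Section ConvexHull.
Variables (R : realType) (d : nat).
Implicit Types (A : set 'rV[R]_d) (x y : 'rV[R]_d).

Lemma convex_setP A :
  @convex_set R 'rV[R]_d A <->
  (forall x y (t : R), A x -> A y -> 0 <= t <= 1 -> A (t *: x + (1 - t) *: y)).
Proof.
split=> [cA x y t Ax Ay t01|cA x y t /set_mem Ax /set_mem Ay].
  pose t' : {i01 R} := @Itv01 R t (proj1 (andP t01)) (proj2 (andP t01)).
  by have /set_mem := cA x y t' (mem_set Ax) (mem_set Ay).
by apply/mem_set; apply: (cA x y t%:num) => //; rewrite ge0 le1.
Qed.

Lemma convex_conv_hull A : @convex_set R 'rV[R]_d (conv_hull A).
Proof.
apply/convex_setP => x y t Ax Ay t01 B [cB AB].
by have /convex_setP := cB; apply => //; [apply: Ax|apply: Ay].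
Qed.

(** If [v] is outside [A], the points of the hull with [l y < l v] form a convex set containing [A],
    hence the whole hull and [v] itself, which is absurd. *)
Lemma vertex_conv_hull A : vertex (conv_hull A) `<=` A.
Proof.
move=> v [hv [l lv]]; apply: contrapT => Av.
pose B := conv_hull A `&` [set y | l y < l v].
suff /(_ v hv)[_ /=] : conv_hull A `<=` B by rewrite ltxx.
apply: smallest_sub; last first.
  move=> y Ay; have hy : conv_hull A y by apply: sub_gen_smallest.
  by split=> //; apply: lv => // yv; apply: Av; rewrite -yv.
apply/convex_setP => x y t [hx lx] [hy ly] t01; split.
  by have /convex_setP := @convex_conv_hull A; apply.
rewrite /= linearD !linearZ /=; move: lx ly => /= lx ly.
have [->|t_neq0] := eqVneq t 0; first by lra.
have txv : t * l x < t * l v.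
  by rewrite ltr_pM2l // lt_neqAle eq_sym t_neq0; lra.
have tyv : (1 - t) * l y <= (1 - t) * l v
  by rewrite ler_wpM2l ?(ltW ly) //; lra.
by lra.
Qed.

Lemma lattice_conv_hull A :
  finite_set A -> A `<=` @int_points R d -> lattice_polytope (conv_hull A).
Proof.
move=> finA intA; split; first by exists A.
by move=> v /vertex_conv_hull /intA.
Qed.

Lemma convex_sum_sqr (n : nat) (l : 'I_n -> {scalar 'rV[R]_d}) (a : 'I_n -> R)
    (c : R) :
  @convex_set R 'rV[R]_d [set x | \sum_(i < n) (l i x - a i) ^+ 2 <= c].
Proof.
apply/convex_setP => x y t /= xc yc t01.
have : \sum_(i < n) (l i (t *: x + (1 - t) *: y) - a i) ^+ 2 <=
    t * \sum_(i < n) (l i x - a i) ^+ 2 +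
    (1 - t) * \sum_(i < n) (l i y - a i) ^+ 2.
  rewrite !mulr_sumr -big_split /=; apply: ler_sum => i _.
  rewrite linearD !linearZ /= -subr_ge0.
  (* The convexity defect of a square; the shift [a i] cancels. *)
  rewrite [leRHS](_ : _ = t * (1 - t) * (l i x - l i y) ^+ 2); last by ring.
  by rewrite mulr_ge0 ?sqr_ge0 // mulr_ge0; lra.
move: xc yc; set u := (X in X <= c); set v := (X in _ -> X <= c -> _) => xc yc.
have tu : t * u <= t * c by rewrite ler_wpM2l //; lra.
have tv : (1 - t) * v <= (1 - t) * c by rewrite ler_wpM2l //; lra.
by rewrite -/u -/v => /le_trans; apply; lra.
Qed.

End ConvexHull.

(** The left kernel of the transposed coefficient matrix consists of the common zeros of the
    forms. *)
Lemma full_rank_systemP (R : realType) (d : nat)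
    (l : 'I_d -> {scalar 'rV[R]_d}) :
  (forall x, (forall i, l i x = 0) -> x = 0) -> full_rank_system l.
Proof.
move=> l0; rewrite /full_rank_system -mxrank_tr; apply/eqP.
apply: inj_row_free => v vM; apply: l0 => i.
move/rowP/(_ i): vM; rewrite !mxE => <-.
rewrite {1}[v]row_sum_delta linear_sum /=; apply: eq_bigr => j _.
by rewrite linearZ !mxE.
Qed.

(** * Enumeration of the lattice points with small quadratic value *)

(** This is [sum_i (5 x_i + S - 2)^2] at [x = (a, b, c, e, 0) + f (1/2, ..., 1/2)]: here
    [x_5 = f/2], so [u = 5 x_5 + S - 2], and [5 x_1 + S - 2 = 5 a + u]. *)
Definition delaunay_form (a b c e f : int) : int :=
  let u := a + b + c + e + 5 * f - 2 in
  (5 * a + u) ^+ 2 + (5 * b + u) ^+ 2 + (5 * c + u) ^+ 2 + (5 * e + u) ^+ 2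
    + u ^+ 2.

Definition delaunay_vertices : seq (seq int) :=
  [:: [:: 0; 0; 0; 0; 0]; [:: 1; 0; 0; 0; 0]; [:: 0; 1; 0; 0; 0];
      [:: 0; 0; 1; 0; 0]; [:: 0; 0; 0; 1; 0]; [:: -1; -1; -1; -1; 2]].

(** Each of the five squares is at most 20, so its root lies in [-4, 4]. Subtracting [u] gives
    [|5 a| <= 8], so [a], [b], [c], [e] are in {-1, 0, 1}; then [5 f = u + 2 - a - b - c - e] lies
    in [-6, 10]. The remaining cases are checked by computation. *)
Lemma delaunay_form_le20 (a b c e f : int) :
  delaunay_form a b c e f <= 20 -> [:: a; b; c; e; f] \in delaunay_vertices.
Proof.
pose r : seq int := [:: -1; 0; 1; 2].
have chk : all (fun a => all (fun b => all (fun c => all (fun e => all (fun f =>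
    (delaunay_form a b c e f <= 20) ==>
    ([:: a; b; c; e; f] \in delaunay_vertices)) r) r) r) r) r.
  by vm_compute.
move=> h.
suff [ar br cr er fr] : [/\ a \in r, b \in r, c \in r, e \in r & f \in r].
  by move/allP/(_ a ar)/allP/(_ b br)/allP/(_ c cr)/allP/(_ e er)/allP/(_ f fr)
    : chk => /implyP; apply.
clear chk; move: h; rewrite /delaunay_form.
set u := _ - 2 => h.
have sqr_small (m : int) : m ^+ 2 <= 20 -> -4 <= m <= 4.
  move=> m20; apply/andP; split; rewrite leNgt; apply/negP => m4.
    have m5 : m <= -5 by lia.
    by nra.
  have m5 : 5 <= m by lia.
  by nra.
have := sqr_ge0 u; have := sqr_ge0 (5 * a + u); have := sqr_ge0 (5 * b + u).
have := sqr_ge0 (5 * c + u); have := sqr_ge0 (5 * e + u) => e0 c0 b0 a0 u0.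
have /sqr_small ub : u ^+ 2 <= 20 by lra.
have /sqr_small ab : (5 * a + u) ^+ 2 <= 20 by lra.
have /sqr_small bb : (5 * b + u) ^+ 2 <= 20 by lra.
have /sqr_small cb : (5 * c + u) ^+ 2 <= 20 by lra.
have /sqr_small eb : (5 * e + u) ^+ 2 <= 20 by lra.
have uE : u = a + b + c + e + 5 * f - 2 by [].
clear h e0 c0 b0 a0 u0; clearbody u; rewrite !inE.
by split; lia.
Qed.

(** The default value 0 of [nth] pads short lists, so lists of length five give points in every
    dimension [d >= 5]. *)
Definition row_of_seq (R : realType) (d : nat) (s : seq int) : 'rV[R]_d :=
  \row_(j < d) (s`_j)%:~R.

Lemma row_of_seq_int (R : realType) (d : nat) (s : seq int) :
  @int_points R d (row_of_seq R d s).
Proof. by apply/mxOverP => i j; rewrite mxE intr_int. Qed.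

(** * The ellipsoid and its lattice points *)

Section DelaunayEllipsoid.
Variables (R : realType) (k : nat).
Local Notation d := k.+4.+1.
Implicit Types x y : 'rV[R]_d.

(** Indices are natural numbers so that sums over ['I_d] can be split as sums over ranges; only
    [n < d] is meaningful. *)
Definition coord (n : nat) x : R := x 0 (inord n).

Lemma coord_linear n : scalar (coord n).
Proof. by move=> t x y; rewrite /coord !mxE. Qed.

HB.instance Definition _ n :=
  GRing.isLinear.Build R 'rV[R]_d R _ (coord n) (coord_linear n).

Lemma coord_row_of_seq n s : (n < d)%N ->
  coord n (row_of_seq R d s) = (s`_n)%:~R.
Proof. by move=> nd; rewrite /coord mxE inordK. Qed.

Lemma coord_ord x (i : 'I_d) : coord i x = x 0 i.
Proof. by rewrite /coord inord_val. Qed.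

(** In the original coordinates this is [S + 5 x_5], not [S]. *)
Definition delaunay_sum x : R :=
  coord 0 x + coord 1 x + coord 2 x + coord 3 x + 5 * coord 4 x.

(* Coefficients in the basis e_1, ..., e_4, (1/2, ..., 1/2); the factor
   1 / sqrt 20 makes the squared radius equal to 1. *)
Definition ellipsoid_form (n : nat) x : R :=
  (Num.sqrt 20)^-1 *
    ((n != 4)%N%:R * 5 * coord n x + (n < 5)%N%:R * delaunay_sum x).

Lemma ellipsoid_form_linear n : scalar (ellipsoid_form n).
Proof.
by move=> t x y; rewrite /ellipsoid_form /delaunay_sum !linearP /=; ring.
Qed.

HB.instance Definition _ n := GRing.isLinear.Build R 'rV[R]_d R _
  (ellipsoid_form n) (ellipsoid_form_linear n).

Definition ellipsoid_shift (n : nat) : R :=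
  (Num.sqrt 20)^-1 * ((n < 5)%N%:R * 2).

Definition ellipsoid_quad x : R :=
  \sum_(i < d) (ellipsoid_form i x - ellipsoid_shift i) ^+ 2.

Lemma ellipsoid_quadE x : let u := delaunay_sum x - 2 in
  ellipsoid_quad x = 20^-1 *
    ((5 * coord 0 x + u) ^+ 2 + (5 * coord 1 x + u) ^+ 2
     + (5 * coord 2 x + u) ^+ 2 + (5 * coord 3 x + u) ^+ 2 + u ^+ 2
     + \sum_(5 <= n < d) (5 * coord n x) ^+ 2).
Proof.
rewrite /ellipsoid_quad -(big_mkord xpredT
  (fun n => (ellipsoid_form n x - ellipsoid_shift n) ^+ 2)) /=.
(* With [20^-1] written as a square, [ring] can treat the inverse root as an atom. *)
have s20 : 20^-1 = (Num.sqrt 20)^-1 ^+ 2 :> R by rewrite exprVn sqr_sqrtr.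
rewrite mulrDr mulr_sumr s20; do 5 (rewrite big_ltn //).
rewrite !addrA; congr (_ + _); last first.
  apply: eq_big_nat => n /andP[n5 _].
  by rewrite /ellipsoid_form /ellipsoid_shift ltnNge n5 gtn_eqF //=; ring.
by rewrite /ellipsoid_form /ellipsoid_shift /delaunay_sum /=; ring.
Qed.

Lemma ellipsoid_form_full_rank :
  full_rank_system (fun i : 'I_d => ellipsoid_form i : {scalar 'rV[R]_d}).
Proof.
apply: full_rank_systemP => x lx.
have s0 : (Num.sqrt 20)^-1 != 0 :> R by rewrite invr_eq0 sqrtr_eq0 -ltNge.
have {lx} lx n : (n < d)%N ->
    (n != 4)%N%:R * 5 * coord n x + (n < 5)%N%:R * delaunay_sum x = 0.
  move=> nd; have /eqP := lx (Ordinal nd).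
  by rewrite /= mulf_eq0 (negPf s0) => /eqP.
(* The form of index 4 kills [delaunay_sum]; the others then reduce to single coordinates, and the
   sum returns coordinate 4. *)
have u0 : delaunay_sum x = 0 by have := lx 4%N isT; rewrite /=; lra.
have cx n : (n < d)%N -> (n != 4)%N -> coord n x = 0.
  move=> nd n4; have := lx n nd; rewrite n4 u0 mulr0 addr0 mul1r.
  by move/eqP; rewrite mulf_eq0 pnatr_eq0 /= => /eqP.
apply/rowP => i; rewrite mxE -coord_ord.
have [->|i4] := eqVneq (i : nat) 4%N; last by apply: cx.
by move: u0; rewrite /delaunay_sum (cx 0) // (cx 1) // (cx 2) // (cx 3) //; lra.
Qed.

Lemma ellipsoid_quad_row s : size s = 5%N ->
  let: a := s`_0 in let: b := s`_1 in let: c := s`_2 in let: e := s`_3 in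
  ellipsoid_quad (row_of_seq R d s) =
    20^-1 * (delaunay_form a b c e s`_4)%:~R.
Proof.
move=> s5; rewrite ellipsoid_quadE big_nat_cond big1 => [|n /andP[/andP[n5 nd] _]].
  rewrite /delaunay_sum !coord_row_of_seq // /delaunay_form.
  by rewrite !(rmorphD, rmorphB, rmorphXn, rmorphM) /=; ring.
by rewrite coord_row_of_seq // nth_default ?s5 //; ring.
Qed.

Definition delaunay_ellipsoid : set 'rV[R]_d := [set x | ellipsoid_quad x = 1].

Lemma delaunay_vertices_ellipsoid s :
  s \in delaunay_vertices -> delaunay_ellipsoid (row_of_seq R d s).
Proof.
move=> sV; have s5 : size s = 5%N.
  by apply/eqP; move: s sV; apply/allP.
have q20 : delaunay_form s`_0 s`_1 s`_2 s`_3 s`_4 = 20.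
  by apply/eqP; move: s sV {s5}; apply/allP; vm_compute.
by rewrite /delaunay_ellipsoid /= ellipsoid_quad_row // q20 mulVf // pnatr_eq0.
Qed.

Lemma delaunay_ball_int x : ellipsoid_quad x <= 1 -> @int_points R d x ->
  exists2 s, s \in delaunay_vertices & x = row_of_seq R d s.
Proof.
move=> qx /mxOverP intx.
have cx n : exists z : int, coord n x = z%:~R.
  by have /intrP := intx 0 (inord n).
have [a ax] := cx 0%N; have [b bx] := cx 1%N; have [c cx'] := cx 2%N.
have [e ex] := cx 3%N; have [f fx] := cx 4%N.
pose D := delaunay_form a b c e f.
pose T := \sum_(5 <= n < d) (5 * coord n x) ^+ 2.
(* As [D] and [T] are nonnegative, each is at most 20: the first bound leaves the six listed points,
   the second forces every extra coordinate [z] to vanish, since [25 z^2 <= 20]. *)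
have DT : D%:~R + T <= 20 :> R.
  move: qx; rewrite ellipsoid_quadE -/T /D /delaunay_sum ax bx cx' ex fx.
  by rewrite /delaunay_form !(rmorphD, rmorphB, rmorphXn, rmorphM) /=; lra.
have T0 : 0 <= T by apply: sumr_ge0 => n _; apply: sqr_ge0.
have D0 : 0 <= D%:~R :> R.
  by rewrite ler0z /D /delaunay_form !addr_ge0 ?sqr_ge0.
exists [:: a; b; c; e; f].
  apply: delaunay_form_le20; rewrite -/D -(ler_int R).
  by rewrite -[20%:~R]/(20 : R); lra.
apply/rowP => i; rewrite -coord_ord mxE.
have [i5|i5] := ltnP i 5.
  by case: i i5 => [] [|[|[|[|[|//]]]]].
rewrite nth_default //; have [z zi] := cx i.
have : (5 * coord i x) ^+ 2 <= T.
  rewrite /T (bigD1_seq (i : nat)) ?mem_index_iota ?iota_uniq ?i5 ?ltn_ord //=.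
  by rewrite lerDl; apply: sumr_ge0 => n _; apply: sqr_ge0.
rewrite zi => z5.
have : 25 * z ^+ 2 <= 20.
  by rewrite -(ler_int R) rmorphM rmorphXn /=; lra.
by move=> ?; have -> : z = 0 by nia.
Qed.

Lemma conv_hull_ellipsoid_int :
  conv_hull delaunay_ellipsoid `&` @int_points R d =
  [set row_of_seq R d s | s in [set` delaunay_vertices]].
Proof.
apply/seteqP; split=> [x [hx ix]|_ [s sV <-]].
  suff /delaunay_ball_int/(_ ix)[s sV ->] : ellipsoid_quad x <= 1 by exists s.
  move: x hx {ix}; apply: smallest_sub; last by move=> x /= ->.
  exact: (@convex_sum_sqr R d d (fun i : 'I_d => ellipsoid_form i)).
split; last exact: row_of_seq_int.
by apply: sub_gen_smallest; apply: delaunay_vertices_ellipsoid.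
Qed.

End DelaunayEllipsoid.

(** * A lattice point of the third dilate that is not a sum *)

Lemma delaunay_vertices_barycenter (R : realType) (d : nat) :
  conv_hull [set row_of_seq R d s | s in [set` delaunay_vertices]]
    (3^-1 *: row_of_seq R d [:: 0; 0; 0; 0; 1]).
Proof.
set P := conv_hull _; have /convex_setP cP : convex_set P.
  exact: convex_conv_hull.
have mid x y : P x -> P y -> P (2^-1 *: (x + y)).
  move=> Px Py; rewrite scalerDr {2}(_ : 2^-1 = 1 - 2^-1 :> R); last by lra.
  by apply: cP => //; lra.
have Pv s : s \in delaunay_vertices -> P (row_of_seq R d s).
  by move=> sV; apply: sub_gen_smallest; exists s.
have P12 := mid _ _ (Pv [:: 1; 0; 0; 0; 0] isT) (Pv [:: 0; 1; 0; 0; 0] isT).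
have P34 := mid _ _ (Pv [:: 0; 0; 1; 0; 0] isT) (Pv [:: 0; 0; 0; 1; 0] isT).
have P05 := mid _ _ (Pv [:: 0; 0; 0; 0; 0] isT) (Pv [:: -1; -1; -1; -1; 2] isT).
have third : 0 <= (3^-1 : R) <= 1 by lra.
(* Weight 1/3 on the midpoint of two vertices and 2/3 on the mean of the other four gives each
   vertex weight 1/6. *)
have := cP _ _ _ P05 (mid _ _ P12 P34) third; congr P.
apply/rowP => -[j jd]; rewrite !mxE /=.
by case: j jd => [|[|[|[|[|j]]]]] jd /=; rewrite ?nth_nil; field.
Qed.

Theorem mainTheorem2 (R : realType) (d : nat) (hd : (5 <= d)%N) :
  exists E : set 'rV[R]_d,
    ellipsoid E /\
    lattice_polytope (ellipsoid_polytope E) /\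
    ~ normal_polytope (ellipsoid_polytope E).
Proof.
case: d hd => [|[|[|[|[|k]]]]] // _.
pose E := @delaunay_ellipsoid R k.
have PE : ellipsoid_polytope E =
    conv_hull [set row_of_seq R k.+4.+1 s | s in [set` delaunay_vertices]].
  by rewrite /ellipsoid_polytope conv_hull_ellipsoid_int.
exists E; split; last split.
- exists (fun i : 'I_k.+4.+1 => ellipsoid_form i : {scalar 'rV[R]_k.+4.+1}).
  exists (fun i : 'I_k.+4.+1 => ellipsoid_shift R i); split=> //.
  exact: ellipsoid_form_full_rank.
- rewrite PE; apply: lattice_conv_hull.
    by apply: finite_image; apply: finite_seq.
  by move=> _ [s _ <-]; apply: row_of_seq_int.
- move=> [_ /(_ 3%N (row_of_seq R k.+4.+1 [:: 0; 0; 0; 0; 1]))[]].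
    split; last exact: row_of_seq_int.
    exists (3^-1 *: row_of_seq R k.+4.+1 [:: 0; 0; 0; 0; 1]).
      by rewrite PE; apply: delaunay_vertices_barycenter.
    by rewrite scalerA mulfV ?scale1r // pnatr_eq0.
  move=> z zP zE.
  have even4 i : exists n : int, coord 4 (z i) = (2 * n)%:~R.
    have [Pz iz] := zP i.
    (* The polytope lies in [conv_hull E], so [z i] is one of the six vertices, whose last
       coordinate is 0 or 2. *)
    have : (conv_hull E `&` int_points R _) (z i).
      split=> //; move: Pz; apply: smallest_sub => [|x []//].
      exact: convex_conv_hull.
    rewrite conv_hull_ellipsoid_int => -[s sV <-].
    exists (if s`_4 == 0 then 0 else 1); rewrite coord_row_of_seq //.
    congr (_%:~R); apply/eqP; move: s sV.
    by apply/allP; vm_compute.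
  have [n nz] := choice even4.
  have z4 : coord 4 (\sum_(i < 3) z i) = 1%:~R by rewrite zE coord_row_of_seq.
  (* Parity contradiction, moved from [R] to the integers. *)
  have : (\sum_(i < 3) 2 * n i)%:~R = 1%:~R :> R.
    rewrite -z4 linear_sum rmorph_sum; apply: eq_bigr => i _.
    exact: esym (nz i).
  by move/intr_inj; rewrite -mulr_sumr; lia.
Qed.
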